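(* Let $\mathcal{X}$ be a Banach space and consider the problem $$\dot u=F(t,u)+f(t),\quad t\ge 0,\qquad u(0)=u_0,$$ where, with $p>1$, $$\|F(t,u)-F'_u(t,0)u\|\le\alpha(t)\|u\|^p,\qquad \|f(t)\|\le\beta(t),\qquad t\ge 0,\ u\in\mathcal{X},$$ under the setting described in the context. Put $$\zeta(t):=\|U(t)\|\,\|u(0)\|+\int_0^t\|U(t)U^{-1}(\xi)\|\beta(\xi)\,d\xi .$$ Assume that the local solvability Assumption A of the context holds, that $\alpha(t)\ge 0$ satisfies $$\alpha(t)\le\frac{\kappa\beta(t)}{[(\kappa+1)\zeta(t)]^p},\qquad t\ge 0,\quad \kappa>0,$$ and that $u(0)\neq 0$. Then the solution $u(t)$ to the problem exists globally and $$\|u(t)\|<(\kappa+1)\zeta(t),\qquad\forall t\ge 0 .$$ Consequently: (i) if the function $\zeta(t)$ is bounded on $[0,\infty)$, then the solution $u(t)$ is bounded; (ii) if $\lim_{t\to\infty}\zeta(t)=0$, then $\lim_{t\to\infty}u(t)=0$.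
   Context: $F(t,u)$ is an operator function from $\mathbb{R}\times\mathcal{X}$ to $\mathcal{X}$, nonlinear in general for fixed $t\ge 0$; $F'_u(t,u)$ denotes its Fréchet derivative with respect to $u$ for fixed $t$, and $B(t):=F'_u(t,0):=F'_u(t,u)|_{u=0}$. $f$ is a function on $[0,\infty)$ with values in $\mathcal{X}$. The functions $\alpha,\beta$ are nonnegative and in $L^1_{loc}([0,\infty))$, and $\|B(t)\|$ is in $L^1_{loc}([0,\infty))$. $\|\cdot\|$ denotes the norm of $\mathcal{X}$ or the operator norm. $\kappa$ is a constant. $U(t)$ is the solution to $\frac{d}{dt}U(t)=B(t)U(t)$, $t\ge0$, $U(0)=I$, where $I$ is the identity operator in $\mathcal{X}$; it exists globally, and its inverse $U^{-1}(t)$ exists for every $t\ge 0$. A solution means a classical solution: a global solution is a continuously differentiable function on $[0,\infty)$ with values in $\mathcal{X}$ satisfying the equation; a local one is such a function on some $[0,T)$, $T>0$ (on $[t_0,t_0+T)$ when starting at $t_0$). Assumption A: the problem $\dot u=F(t,u)+f(t)$, $t\ge t_0$, $u(t_0)=\tilde u_0$, has a unique local solution for any $t_0\ge 0$ and $\tilde u_0\in B(0,R)\subset\mathcal{X}$, where $B(0,R)$ is the ball centered at the origin with radius $R$ and $R>0$ is sufficiently large.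
   Formalization: Added: F(t,u)+f(t) is jointly continuous on [0,∞)×X. Without it the claim fails: X=ℝ, F=0, f=1 for t≥1 and 0 before, α=0, β=1 satisfies every hypothesis but has no global C¹ solution. *)

(* Defs.v *)
From HB Require Import structures.
From mathcomp Require Export all_boot all_order all_algebra.
From mathcomp Require Export all_classical all_reals all_analysis.
Export Order.TTheory GRing.Theory Num.Theory.
Export numFieldNormedType.Exports.

Set Implicit Arguments.
Unset Strict Implicit.
Unset Printing Implicit Defensive.

#[export] Set Implicit Arguments.
#[export] Unset Strict Implicit.
#[export] Unset Printing Implicit Defensive.

Local Open Scope classical_set_scope.
Local Open Scope ring_scope.

Section BoundedOperators.
Context {R : realType} {X : normedModType R}.

Definition bop_pred : {pred X -> X} :=
  fun A => `[< linear A /\ continuous A >].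

Record bop := Bop { bop_fun :> X -> X ; bop_funP : bop_fun \in bop_pred }.

HB.instance Definition _ := [isSub for bop_fun].
HB.instance Definition _ := gen_eqMixin bop.
HB.instance Definition _ := [Choice of bop by <:].

Lemma bopP (A : bop) : linear A /\ continuous A.
Proof. by case: A => A /= /asboolP. Qed.

Lemma bop_ext (A B : bop) : A =1 B -> A = B.
Proof. by move=> AB; apply/val_inj/funext. Qed.

Lemma bop_submod_closed : submod_closed bop_pred.
Proof.
split=> [|a A B /asboolP[lA cA] /asboolP[lB cB]]; apply/asboolP; split.
- by move=> k x y; rewrite -[LHS]/(0 : X) -[RHS]/(k *: (0 : X) + 0) scaler0 addr0.
- exact: cst_continuous.
- move=> k x y; rewrite -[LHS]/(a *: A (k *: x + y) + B (k *: x + y)).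
  rewrite -[RHS]/(k *: (a *: A x + B x) + (a *: A y + B y)) lA lB.
  by rewrite !scalerDr !scalerA (mulrC a) addrACA.
- by move=> x; apply: cvgD; [apply: cvgZl_tmp; exact: cA|exact: cB].
Qed.

HB.instance Definition _ :=
  GRing.isSubmodClosed.Build R (X -> X) bop_pred bop_submod_closed.
HB.instance Definition _ := [SubChoice_isSubLmodule of bop by <:].

Definition opnorm (A : bop) : R :=
  sup [set `|A x| | x in [set x : X | `|x| <= 1]].

Let opset (A : bop) := [set `|A x| | x in [set x : X | `|x| <= 1]].

Lemma bop_bounded (A : bop) : exists M, forall x, `|x| <= 1 -> `|A x| <= M.
Proof.
have [lA cA] := bopP A.
pose L : {linear X -> X} := HB.pack (A : X -> X)
  (GRing.isLinear.Build _ _ _ _ _ lA).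
have /bounded_funP/(_ 1)//: bounded_near L (nbhs 0).
by apply/linear_bounded_continuous; exact: cA.
Qed.

Lemma bop0 (A : bop) : A 0 = 0.
Proof.
have [lA _] := bopP A.
by have := lA (-1) 0 0; rewrite scaler0 addr0 scaleN1r addNr.
Qed.

Lemma bopZ (A : bop) k x : A (k *: x) = k *: A x.
Proof.
by have [lA _] := bopP A; have := lA k x 0; rewrite bop0 !addr0.
Qed.

Lemma opset_has_sup (A : bop) : has_sup (opset A).
Proof.
split; first by exists `|A 0|, 0 => //=; rewrite normr0.
by have [M AM] := bop_bounded A; exists M => _ [x /= x1 <-]; exact: AM.
Qed.

Lemma opnorm_unit (A : bop) x : `|x| <= 1 -> `|A x| <= opnorm A.
Proof.
by move=> x1; apply: sup_upper_bound; [exact: opset_has_sup|exists x].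
Qed.

Lemma opnorm_le (A : bop) M :
  (forall x, `|x| <= 1 -> `|A x| <= M) -> opnorm A <= M.
Proof.
move=> AM; apply: ge_sup; first by have [] := opset_has_sup A.
by move=> _ [x /= x1 <-]; exact: AM.
Qed.

Lemma opnormP (A : bop) x : `|A x| <= opnorm A * `|x|.
Proof.
have [->|x0] := eqVneq x 0; first by rewrite bop0 !normr0 mulr0.
have nx0 : 0 < `|x| by rewrite normr_gt0.
have := @opnorm_unit A (`|x|^-1 *: x).
rewrite bopZ !normrZ normfV normr_id mulVf ?gt_eqF// lexx => /(_ isT).
by rewrite mulrC ler_pdivrMr.
Qed.

Lemma opnorm_ge0 (A : bop) : 0 <= opnorm A.
Proof.
by apply: le_trans (@opnorm_unit A 0 _); rewrite ?normr_ge0 ?normr0.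
Qed.

Lemma bopDE (A B : bop) x : (A + B) x = A x + B x. Proof. by []. Qed.

Lemma bopZE k (A : bop) x : (k *: A) x = k *: A x. Proof. by []. Qed.

Lemma bop0E x : (0 : bop) x = 0. Proof. by []. Qed.

Lemma ler_opnormD (A B : bop) : opnorm (A + B) <= opnorm A + opnorm B.
Proof.
apply: opnorm_le => x x1; rewrite bopDE (le_trans (ler_normD _ _))//.
by rewrite lerD// opnorm_unit.
Qed.

Lemma opnormZ k (A : bop) : opnorm (k *: A) = `|k| * opnorm A.
Proof.
have le k' A' : opnorm (k' *: A') <= `|k'| * opnorm A'.
  apply: opnorm_le => x x1.
  by rewrite bopZE normrZ ler_wpM2l// opnorm_unit.
apply/eqP; rewrite eq_le le/=.
have [->|k0] := eqVneq k 0; first by rewrite normr0 mul0r opnorm_ge0.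
rewrite -ler_pdivlMl ?normr_gt0// -normfV.
by apply: le_trans (le _ _); rewrite scalerA mulVf// scale1r.
Qed.

Lemma opnorm0_eq0 (A : bop) : opnorm A = 0 -> A = 0.
Proof.
move=> A0; apply: bop_ext => x; rewrite bop0E.
by apply/normr0_eq0/le_anti; rewrite normr_ge0 andbT -(mul0r `|x|) -A0 opnormP.
Qed.

HB.instance Definition _ :=
  Lmodule_isNormed.Build R bop ler_opnormD opnormZ opnorm0_eq0.

Lemma bop_normE (A : bop) :
  `|A| = sup [set `|A x| | x in [set x : X | `|x| <= 1]].
Proof. by []. Qed.

Fact bop_id_subproof : (@id X) \in bop_pred.
Proof. by apply/asboolP; split=> // x. Qed.
Definition bop_id : bop := Bop bop_id_subproof.

Fact bop_comp_subproof (A B : bop) : (A \o B) \in bop_pred.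
Proof.
have [[lA cA] [lB cB]] := (bopP A, bopP B).
apply/asboolP; split=> [k x y|x] /=; first by rewrite lB lA.
by apply: continuous_comp; [exact: cB|exact: cA].
Qed.
Definition bop_comp (A B : bop) : bop := Bop (bop_comp_subproof A B).

End BoundedOperators.
Arguments bop {R} X.

Section Setting.
Context {R : realType}.
Implicit Types (I : set R) (t : R).

(* At an endpoint of I belonging to I this is the one-sided derivative. *)
Definition derivative_within (V : normedModType R) I (v : R -> V) t (l : V) :=
  (s - t)^-1 *: (v s - v t) @[s --> within I t^'] --> l.

Definition classical_solution (V : normedModType R) (G : R -> V -> V)
    I (v : R -> V) :=
  exists dv : R -> V, {within I, continuous dv} /\
    forall t, I t -> derivative_within I v t (dv t) /\ dv t = G t (v t).

(* Unique local solvability for all initial times and all initial values in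
   the ball of radius r; the length T of the interval may depend on both. *)
Definition locally_solvable (V : normedModType R) (G : R -> V -> V) (r : R) :=
  forall (t0 : R) (x0 : V), 0 <= t0 -> `|x0| < r ->
    exists2 T, 0 < T &
      exists u : R -> V,
        [/\ classical_solution G `[t0, t0 + T[ u, u t0 = x0 &
          forall v : R -> V, classical_solution G `[t0, t0 + T[ v ->
            v t0 = x0 -> forall t, t0 <= t < t0 + T -> v t = u t].

(* Local solvability in the ball B(0, r) with r "sufficiently large": for each finite
   time horizon, r dominates the a priori bound b up to that time. When b is
   bounded one r can serve for all horizons; a single r cannot be large enough
   when b is unbounded. *)
Definition locally_solvable_large (V : normedModType R) (G : R -> V -> V)
    (b : R -> R) :=
  forall T, 0 <= T -> exists2 r,
    (forall t, 0 <= t <= T -> b t <= r) & locally_solvable G r.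

Definition L1loc (g : R -> R) :=
  forall T, 0 <= T ->
    lebesgue_measure.-integrable `[0, T] (EFin \o g).

(* U solves dU/dt = B(t) U, U(0) = I, in the operator norm, and Uinv t is the
   two-sided inverse of U t. *)
Definition evolution_operator (X : normedModType R) (B U Uinv : R -> bop X) :=
  [/\ classical_solution (fun t A => bop_comp (B t) A) `[0, +oo[ U,
      U 0 = bop_id &
      forall t, 0 <= t -> bop_comp (U t) (Uinv t) = bop_id /\
                          bop_comp (Uinv t) (U t) = bop_id].

Definition zeta (X : normedModType R) (U Uinv : R -> bop X) (beta : R -> R)
    (u0 : X) (t : R) : R :=
  `|U t| * `|u0| +
  \int[lebesgue_measure]_(xi in `[0, t]) (`|bop_comp (U t) (Uinv xi)| * beta xi).

End Setting.

(* Main.v *)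
Require Import Defs.
From mathcomp Require Import measurable_realfun lra.

(** Write a solution by variation of constants,
      u(t) = U(t) u(0) + int_0^t U(t) U^-1(xi) (u' - B u)(xi) dxi.
    As long as |u| <= (kappa + 1) zeta, the bound on alpha turns the nonlinear
    part F(t, u) - B(t) u into something of norm at most kappa beta(t), so that
    |u' - B u| <= (kappa + 1) beta and
      |u(t)| <= |U(t)| |u(0)| + (kappa + 1) int_0^t |U(t) U^-1(xi)| beta(xi) dxi.
    The right-hand side misses (kappa + 1) zeta(t) by kappa |U(t)| |u(0)|, which
    is positive because u(0) != 0 and U(t) is invertible. Hence the inequality
    |u| < (kappa + 1) zeta reproduces itself strictly and, by induction along
    the real line, can never stop being true ([apriori_bound]); the induction can
    pass beyond a time t because zeta is lower semicontinuous from the right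
    there ([zeta_lower]).

    No vector-valued integral is needed: the path xi |-> U(t) U^-1(xi) u(xi) goes
    from U(t) u(0) to u(t), its derivative U(t) U^-1(xi) (u' - B u)(xi) is
    continuous, and the mean value inequality [norm_increment_le] bounds the
    increment by the integral of any integrable majorant of the norm of the
    derivative ([evolution_estimate]).

    For global existence, on [0, T[ the solution stays below a constant r, so u'
    is dominated by the integrable function r |B| + (kappa + 1) beta; therefore
    u has a limit at T and is a solution on the closed interval [0, T]
    ([solves_close]), and local solvability at T carries it beyond T
    ([solves_extend]). Zorn's lemma then yields a solution on [0, +oo[
    ([solves_global]). Zorn is used because local uniqueness only concerns the
    whole interval on which a local solution is provided: two solutions on a
    shorter interval are not known to agree, so there is no a priori coherent
    family of solutions to glue together. Global solutions, on the contrary,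
    can be restricted to these intervals and do agree ([solves_unique]). *)

Local Open Scope classical_set_scope.
Local Open Scope ring_scope.

(** * Induction along a real interval *)

Section RealInduction.
Context {R : realType}.
Implicit Types (a b t s : R) (P : R -> Prop).

(** The supremum [c] of the points up to which [P] holds is one of them (it is
    [a], or the last hypothesis applies) and cannot be less than [b], since [P]
    would then hold on a right neighbourhood of it. *)
Lemma real_induction a b P : P a ->
    (forall t, a <= t < b -> P t ->
       exists2 d, 0 < d & forall s, t < s < t + d -> s <= b -> P s) ->
    (forall t, a < t <= b -> (forall s, a <= s < t -> P s) -> P t) ->
  forall t, a <= t <= b -> P t.
Proof.
move=> Pa Pright Pleft t0 /andP[at0 t0b].
have ab := le_trans at0 t0b.
pose S := [set t | a <= t <= b /\ forall s, a <= s <= t -> P s].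
have Sa : S a.
  by split; [rewrite lexx|move=> s /le_anti <-].
have supS : has_sup S.
  by split; [exists a|exists b => t [/andP[]]].
set c := sup S.
have ac : a <= c by exact: sup_upper_bound.
have cb : c <= b by apply: ge_sup; [exists a|move=> t [/andP[]]].
have Pltc s : a <= s < c -> P s.
  move=> /andP[as_ sc].
  have [|r [_ Pr] sr] := @sup_adherent _ S (c - s) _ supS; first by rewrite subr_gt0.
  by apply: Pr; rewrite as_ /=; move: sr; rewrite -/c; lra.
have Pc : P c.
  move: ac; rewrite le_eqVlt => /predU1P[<-//|ac].
  by apply: Pleft => //; rewrite ac.
have Plec s : a <= s <= c -> P s.
  move=> /andP[as_]; rewrite le_eqVlt => /predU1P[->//|sc].
  by apply: Pltc; rewrite as_.
have [cb'|bc] := ltP c b; last first.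
  by apply: Plec; rewrite at0 (le_trans t0b).
have [|d d0 Pd] := Pright c _ Pc; first by rewrite ac.
(* a point strictly beyond the supremum up to which P still holds *)
pose e := Num.min b (c + d / 2).
have ce : c < e by rewrite /e lt_min cb' /=; lra.
have eb : e <= b by rewrite /e ge_min lexx.
have ed : e <= c + d / 2 by rewrite /e ge_min lexx orbT.
suff : S e by move/(sup_upper_bound supS); rewrite -/c; lra.
split; first by lra.
move=> s /andP[as_ se]; have [sc|cs] := leP s c; first by apply: Plec; lra.
by apply: Pd; lra.
Qed.

End RealInduction.

(** * Limits and one-sided derivatives within a set *)

Lemma cvg_within_sub {R : realType} {V : normedModType R} (I J : set R)
    (v : R -> V) (t : R) (l : V) : J `<=` I ->
  v s @[s --> within I (nbhs t)] --> l -> v s @[s --> within J (nbhs t)] --> l.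
Proof.
by move=> JI; apply: cvg_trans; apply: cvg_app; exact: within_subset.
Qed.

Lemma cvg_within_dnbhs {R : realType} {V : normedModType R} (I : set R)
    (v : R -> V) (t : R) (l : V) :
  v s @[s --> within I (nbhs t)] --> l -> v s @[s --> within I t^'] --> l.
Proof.
by apply: cvg_trans; apply: cvg_app => S hS; exact: (nbhs_dnbhs hS).
Qed.

Lemma subset_segment_ray {R : realType} (T : R) : `[0, T]%classic `<=` `[0, +oo[.
Proof. by apply: subset_itv; rewrite bnd_simp. Qed.

(** Composition through a relative neighbourhood filter: used for functions of
    (time, state) that are only continuous where time is nonnegative. *)
Lemma cvg_within_comp {S : Type} {T U : topologicalType} (F : set_system S)
    {FF : Filter F} (D : set T) (f : S -> T) (g : T -> U) (x : T) (l : U) :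
  f s @[s --> F] --> x -> (\forall s \near F, D (f s)) ->
  g z @[z --> within D (nbhs x)] --> l -> g (f s) @[s --> F] --> l.
Proof.
move=> fx Df gl W Wl; have := fx _ (gl W Wl); rewrite /nbhs /= => h.
by apply: filterS2 Df h => s Ds; exact.
Qed.

Section WithinDerivative.
Context {R : realType} {V : normedModType R}.
Implicit Types (I J : set R) (v w : R -> V) (s t : R) (l : V).

Lemma cvg_withinP I v t l :
  (v s @[s --> within I (nbhs t)] --> l) <->
  (forall e : R, 0 < e -> exists2 d, 0 < d &
     forall s, I s -> `|s - t| < d -> `|v s - l| <= e).
Proof.
split=> [/cvgrPdist_le h e e0|h].
  have /nbhs_ballP[d /= d0 hd] := h _ e0.
  exists d => // s Is st; rewrite distrC; apply: hd => //.
  by rewrite /ball /= distrC.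
apply/cvgrPdist_le => e e0; have [d d0 hd] := h _ e0.
apply/nbhs_ballP; exists d => //= s st Is; rewrite distrC; apply: hd => //.
by rewrite distrC.
Qed.

(** The division-free form of the derivative: it makes sense at [s = t] as well,
    which spares a case distinction in every later estimate. *)
Lemma derivative_withinP I v t l :
  derivative_within I v t l <->
  (forall e : R, 0 < e -> exists2 d, 0 < d &
     forall s, I s -> `|s - t| < d -> `|v s - v t - (s - t) *: l| <= e * `|s - t|).
Proof.
have slopeE s : s != t ->
    `|v s - v t - (s - t) *: l| = `|(s - t)^-1 *: (v s - v t) - l| * `|s - t|.
  move=> st; rewrite -[in RHS]mulrC -normrZ scalerBr scalerA divff ?scale1r//.
  by rewrite subr_eq0.
split=> [/cvgrPdist_le h e e0|h].
  have /nbhs_ballP[d /= d0 hd] := h _ e0.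
  exists d => // s Is st; have [->|nst] := eqVneq s t.
    by rewrite !subrr scale0r subr0 !normr0 mulr0.
  rewrite slopeE// ler_wpM2r// distrC; apply: hd => //.
  by rewrite /ball /= distrC.
apply/cvgrPdist_le => e e0; have [d d0 hd] := h _ e0.
apply/nbhs_ballP; exists d => //= s st nst Is.
rewrite distrC -(ler_pM2r (_ : 0 < `|s - t|)) ?normr_gt0 ?subr_eq0//.
by rewrite -slopeE//; apply: hd => //; rewrite distrC.
Qed.

(** The domain [J] need only be contained in [I] near [t]: this transports
    derivatives between intervals that end at different places. *)
Lemma derivative_within_local I J v w t l r : 0 < r -> v t = w t ->
    (forall s, J s -> `|s - t| < r -> I s /\ v s = w s) ->
  derivative_within I v t l -> derivative_within J w t l.
Proof.
move=> r0 vwt vw /derivative_withinP h; apply/derivative_withinP => e e0.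
have [d d0 hd] := h _ e0; exists (Num.min d r); first by rewrite lt_min d0.
move=> s Js; rewrite lt_min => /andP[sd sr].
by have [Is <-] := vw _ Js sr; rewrite -vwt; exact: hd.
Qed.

Lemma derivative_within_sub I J v t l : J `<=` I ->
  derivative_within I v t l -> derivative_within J v t l.
Proof.
by move=> JI; apply: (@derivative_within_local _ _ _ _ _ _ 1) => // s /JI.
Qed.

(** Used where two solutions meet: a left and a right derivative with the same
    value form a two-sided derivative. *)
Lemma derivative_withinU I J v t l :
  derivative_within I v t l -> derivative_within J v t l ->
  derivative_within (I `|` J) v t l.
Proof.
move=> /derivative_withinP hI /derivative_withinP hJ.
apply/derivative_withinP => e e0.
have [[d d0 hd] [r r0 hr]] := (hI _ e0, hJ _ e0).
exists (Num.min d r); first by rewrite lt_min d0.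
by move=> s [Is|Js]; rewrite lt_min => /andP[sd sr]; [exact: hd|exact: hr].
Qed.

Lemma derivative_within_cvg I v t l : derivative_within I v t l ->
  v s @[s --> within I (nbhs t)] --> v t.
Proof.
move=> /derivative_withinP h; apply/cvg_withinP => e e0.
have [d d0 hd] := h _ (ltr01 : 0 < 1 :> R).
(* + 1 keeps K positive when l = 0 *)
pose K := `|l| + 1; have K0 : 0 < K by rewrite ltr_wpDl.
exists (Num.min d (e / K)); first by rewrite lt_min d0 divr_gt0.
move=> s Is; rewrite lt_min => /andP[sd]; rewrite ltr_pdivlMr// => se.
rewrite -(subrK ((s - t) *: l) (v s - v t)).
apply: le_trans (ler_normD _ _) _; apply: le_trans (ltW se).
rewrite normrZ /K mulrDr mulr1 addrC lerD2l -[leRHS]mul1r.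
exact: hd.
Qed.

End WithinDerivative.

(** * The mean value inequality *)

Section MeanValue.
Context {R : realType} {V : normedModType R}.
Local Notation mu := (@lebesgue_measure R).
Implicit Types (v dv : R -> V) (m : R -> R) (a b : R).

Lemma integrable_itv_sub m a b c d : a <= c -> d <= b ->
  mu.-integrable `[a, b] (EFin \o m) -> mu.-integrable `[c, d] (EFin \o m).
Proof.
move=> ac db; apply: integrableS => //; apply: subset_itv; rewrite bnd_simp//.
Qed.

(** The splitting point may belong to both pieces, since it is a null set. *)
Lemma Rintegral_itv_split m a t s : a <= t -> t <= s ->
  mu.-integrable `[a, s] (EFin \o m) ->
  \int[mu]_(x in `[a, s]) m x =
  \int[mu]_(x in `[a, t]) m x + \int[mu]_(x in `[t, s]) m x.
Proof.
move=> at_ ts im.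
have := @Rintegral_itvB R m (BLeft a) (BRight s) t im.
rewrite !bnd_simp => /(_ at_ ts) E.
rewrite -[in X in _ + X]Rintegral_itv_obnd_cbnd -?E; first by rewrite addrC subrK.
by apply: integrableS im => //; apply: subset_itv; rewrite bnd_simp.
Qed.

Lemma Rintegral_itv_cst a b (c : R) : a <= b ->
  \int[mu]_(x in `[a, b]) c = c * (b - a).
Proof.
move=> ab; rewrite Rintegral_cst//= lebesgue_measure_itv/= lte_fin.
move: ab; rewrite le_eqVlt => /predU1P[->|->]; last by [].
by rewrite ltxx subrr.
Qed.

(** The comparison may fail at the right endpoint: in the applications the
    integrand is only known to be controlled strictly before the final time. *)
Lemma le_Rintegral_itvr m a b m' : 
  mu.-integrable `[a, b] (EFin \o m) -> mu.-integrable `[a, b] (EFin \o m') ->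
  (forall t, a <= t < b -> m t <= m' t) ->
  \int[mu]_(x in `[a, b]) m x <= \int[mu]_(x in `[a, b]) m' x.
Proof.
move=> im im' mm'.
have sub : `[a, b[ `<=` `[a, b] by apply: subset_itv; rewrite bnd_simp.
have ho f : mu.-integrable `[a, b] (EFin \o f) -> mu.-integrable `[a, b[ (EFin \o f).
  exact: integrableS.
rewrite -!Rintegral_itv_bndo_bndc; [|exact: ho..].
by apply: le_Rintegral; [|exact: ho..|] => // t /=; rewrite in_itv /=; exact: mm'.
Qed.

(** By induction on [t], [|v t - v a| <= int_a^t |dv| + e (t - a)] for each
    [e > 0]. To move from [t] to a nearby [s > t], half of the slack [e] pays for
    the error of the linear approximation of [v] and the other half for the
    difference between [|dv x|] and [|dv t|] on [[t, s]]. The bound passes to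
    limits from the left because its right-hand side increases with [t]. *)
Lemma norm_increment_le_norm v dv a b : a <= b ->
    (forall t, a <= t <= b -> derivative_within `[a, b] v t (dv t)) ->
    {within `[a, b], continuous dv} ->
  `|v b - v a| <= \int[mu]_(x in `[a, b]) `|dv x|.
Proof.
move=> ab vdv cdv; pose phi x := `|dv x|.
have phi0 x : 0 <= phi x by exact: normr_ge0.
have cphi : {within `[a, b], continuous phi}.
  by move=> x; apply: cvg_norm; exact: cdv.
have iphi : mu.-integrable `[a, b] (EFin \o phi).
  by apply: continuous_compact_integrable => //; exact: segment_compact.
suff H e : 0 < e -> `|v b - v a| <= \int[mu]_(x in `[a, b]) phi x + e * (b - a).
  apply/ler_addgt0Pr => e e0; have ba : 0 <= b - a by rewrite subr_ge0.
  (* + 1 in the denominator covers the case a = b *)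
  apply: le_trans (H (e / (b - a + 1)) _) _; first by rewrite divr_gt0//; lra.
  rewrite lerD2l mulrAC ler_pdivrMr; last by lra.
  by rewrite ler_pM2l//; lra.
move=> e0.
apply: (@real_induction R a b
  (fun t => `|v t - v a| <= \int[mu]_(x in `[a, t]) phi x + e * (t - a))).
- by rewrite !subrr normr0 mulr0 addr0 Rintegral_ge0.
- move=> t /andP[at_ tb] Pt.
  have tab : a <= t <= b by rewrite at_ ltW.
  have e20 : 0 < e / 2 by lra.
  have /derivative_withinP/(_ _ e20)[d d0 hd] := vdv t tab.
  have /cvg_withinP/(_ _ e20)[r r0 hr] :=
    (iffLR (subspace_continuousP `[a, b] phi) cphi) t tab.
  exists (Num.min d r); first by rewrite lt_min d0.
  move=> s /andP[ts sdr] sb.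
  have : s - t < Num.min d r by lra.
  rewrite lt_min => /andP[sd sr].
  have st0 : 0 < s - t by lra.
  have sE : `|s - t| = s - t by rewrite gtr0_norm.
  have [iat its] : mu.-integrable `[a, s] (EFin \o phi) /\
      mu.-integrable `[t, s] (EFin \o phi).
    by split; apply: integrable_itv_sub iphi => //; lra.
  rewrite (@Rintegral_itv_split _ _ t)//; last exact: ltW.
  have I2 : (phi t - e / 2) * (s - t) <= \int[mu]_(x in `[t, s]) phi x.
    rewrite -Rintegral_itv_cst ?(ltW ts)//; apply: le_Rintegral_itvr => //.
      by apply: continuous_compact_integrable;
        [exact: segment_compact|exact: cst_continuous].
    move=> x /andP[tx xs]; have : `|phi x - phi t| <= e / 2.
      apply: hr; first by rewrite /= in_itv /=; lra.
      by rewrite ger0_norm; lra.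
    by rewrite ler_norml => /andP[]; lra.
  have I3 : `|v s - v t| <= (phi t + e / 2) * (s - t).
    rewrite -(subrK ((s - t) *: dv t) (v s - v t)).
    apply: le_trans (ler_normD _ _) _.
    rewrite mulrDl addrC normrZ sE (mulrC (s - t)) lerD2l -[in leRHS]sE.
    by apply: hd; [rewrite /= in_itv /=; lra|rewrite sE].
  rewrite -(subrK (v t) (v s)) -addrA; apply: le_trans (ler_normD _ _) _.
  by lra.
- move=> t /andP[at_ tb] Plt.
  have tab : a <= t <= b by rewrite tb ltW.
  apply/ler_addgt0Pr => r r0.
  have /derivative_within_cvg/cvg_withinP/(_ _ r0)[d d0 hd] := vdv t tab.
  pose s := Num.max a (t - d / 2).
  have st : s < t by rewrite /s gt_max at_ /=; lra.
  have as_ : a <= s by rewrite /s le_max lexx.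
  have sd : t - d / 2 <= s by rewrite /s le_max lexx orbT.
  have Ps := Plt s; rewrite as_ st in Ps; have {}Ps := Ps isT.
  have Is : \int[mu]_(x in `[a, s]) phi x <= \int[mu]_(x in `[a, t]) phi x.
    rewrite (@Rintegral_itv_split _ a s t) ?(ltW st)//.
      by rewrite lerDl Rintegral_ge0.
    by apply: integrable_itv_sub iphi => //; lra.
  have vst : `|v s - v t| <= r.
    apply: hd; first by rewrite /= in_itv /=; lra.
    by rewrite ltr0_norm; lra.
  rewrite -(subrK (v s) (v t)) -addrA; apply: le_trans (ler_normD _ _) _.
  have est : e * (s - a) <= e * (t - a) by rewrite ler_pM2l//; lra.
  by rewrite (distrC (v t)); lra.
- by rewrite ab lexx.
Qed.

(** A majorant [m] that is merely integrable is allowed because the inequality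
    is first proved with the continuous function [|dv|] itself. *)
Lemma norm_increment_le v dv m a b : a <= b ->
    (forall t, a <= t <= b -> derivative_within `[a, b] v t (dv t)) ->
    {within `[a, b], continuous dv} ->
    mu.-integrable `[a, b] (EFin \o m) ->
    (forall t, a <= t < b -> `|dv t| <= m t) ->
  `|v b - v a| <= \int[mu]_(x in `[a, b]) m x.
Proof.
move=> ab vdv cdv im dvm; apply: le_trans (norm_increment_le_norm ab vdv cdv) _.
apply: le_Rintegral_itvr => //.
apply: continuous_compact_integrable; first exact: segment_compact.
by move=> x; apply: cvg_norm; exact: cdv.
Qed.

End MeanValue.

(** * Bounded operators *)

Section Operators.
Context {R : realType} {X : normedModType R}.
Implicit Types (A B C : bop X) (x y : X).

Lemma bopBE A B x : (A - B) x = A x - B x.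
Proof. by []. Qed.

Lemma bopB A x y : A (x - y) = A x - A y.
Proof.
have [lA _] := bopP A.
by rewrite -scaleN1r addrC lA scaleN1r addrC.
Qed.

Lemma bop_norm_apply A x : `|A x| <= `|A| * `|x|.
Proof. exact: opnormP. Qed.

Lemma bop_comp_norm_le A B : `|bop_comp A B| <= `|A| * `|B|.
Proof.
apply: opnorm_le => x x1; apply: le_trans (bop_norm_apply A (B x)) _.
by rewrite ler_wpM2l//; exact: opnorm_unit.
Qed.

Lemma bop_compBr A B C : bop_comp A (B - C) = bop_comp A B - bop_comp A C.
Proof. by apply: bop_ext => x; exact: bopB. Qed.

Lemma bop_compBl A B C : bop_comp (A - B) C = bop_comp A C - bop_comp B C.
Proof. exact: bop_ext. Qed.

Lemma cvg_dominated {T : Type} (F : set_system T) {FF : Filter F}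
    (V : normedModType R) (f : T -> V) (g : T -> R) l :
  (\forall s \near F, `|f s - l| <= g s) -> g s @[s --> F] --> 0 ->
  f s @[s --> F] --> l.
Proof.
move=> fg g0; apply/subr_cvg0/norm_cvg0P.
apply: (@squeeze_cvgr _ _ _ _ (fun=> 0) g) => //; last exact: cvg_cst.
by apply: filterS fg => s ->; rewrite normr_ge0.
Qed.

Lemma cvg_dist0 {T : Type} (F : set_system T) {FF : Filter F}
    (V : normedModType R) (f : T -> V) l (k : R) :
  f s @[s --> F] --> l -> k * `|f s - l| @[s --> F] --> 0.
Proof.
move=> fl; rewrite -[0](mulr0 k); apply: cvgMl_tmp.
by rewrite -(normr0 V); apply: cvg_norm; apply/subr_cvg0.
Qed.

Lemma cvg_bop_apply {T : Type} (F : set_system T) {FF : Filter F}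
    (A : T -> bop X) (x : T -> X) A0 x0 :
  A s @[s --> F] --> A0 -> x s @[s --> F] --> x0 -> A s (x s) @[s --> F] --> A0 x0.
Proof.
move=> AA0 xx0.
have -> : (fun s => A s (x s)) = (fun s => (A s - A0) (x s) + A0 (x s)).
  by apply/funext => s; rewrite bopBE subrK.
rewrite -[A0 x0]add0r; apply: cvgD; last first.
  by apply: (cvg_comp _ A0 xx0); have [_] := bopP A0; exact.
apply: (@cvg_dominated _ _ _ _ _ (fun s => `|A s - A0| * `|x s|)).
  by apply: nearW => s; rewrite subr0 bop_norm_apply.
rewrite -[0](mul0r `|x0|) -(normr0 (bop X)); apply: cvgM; last exact: cvg_norm.
by apply: cvg_norm; apply/subr_cvg0.
Qed.

Lemma cvg_bop_comp {T : Type} (F : set_system T) {FF : Filter F}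
    C (A : T -> bop X) A0 :
  A s @[s --> F] --> A0 -> bop_comp C (A s) @[s --> F] --> bop_comp C A0.
Proof.
move=> AA0; apply: cvg_dominated (cvg_dist0 `|C| AA0).
by apply: nearW => s; rewrite -bop_compBr bop_comp_norm_le.
Qed.

(** From [Ainv s - A0inv = Ainv s (A0 - A s) A0inv], the factor [|Ainv s|] is at
    most [2 |A0inv|] as soon as [|A0inv| |A s - A0| <= 1/2]; the difference is then
    of the order of [|A s - A0|]. *)
Lemma cvg_bop_inv {T : Type} (F : set_system T) {FF : Filter F}
    (A Ainv : T -> bop X) A0 A0inv :
    (\forall s \near F, bop_comp (Ainv s) (A s) = bop_id) ->
    bop_comp A0 A0inv = bop_id ->
  A s @[s --> F] --> A0 -> Ainv s @[s --> F] --> A0inv.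
Proof.
move=> AinvK A0K AA0; pose k := `|A0inv|.
have dE s : bop_comp (Ainv s) (A s) = bop_id ->
    Ainv s - A0inv = bop_comp (Ainv s) (bop_comp (A0 - A s) A0inv).
  move=> sK; apply: bop_ext => x.
  have A0x : A0 (A0inv x) = x by have := congr1 (fun B : bop X => B x) A0K.
  have Asx : Ainv s (A s (A0inv x)) = A0inv x.
    by have := congr1 (fun B : bop X => B (A0inv x)) sK.
  rewrite -[RHS]/(Ainv s ((A0 - A s) (A0inv x))) !bopBE bopB A0x Asx//.
have dle s : bop_comp (Ainv s) (A s) = bop_id ->
    `|Ainv s - A0inv| <= `|Ainv s| * (`|A0 - A s| * k).
  move=> sK; rewrite dE//; apply: le_trans (bop_comp_norm_le _ _) _.
  by rewrite ler_wpM2l ?opnorm_ge0//; exact: bop_comp_norm_le.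
have d0 : k * `|A s - A0| @[s --> F] --> 0 by exact: cvg_dist0.
have dsmall : \forall s \near F, k * `|A s - A0| <= 2^-1.
  have h0 : (0 : R) < 2^-1 by rewrite invr_gt0.
  exact: (cvgr_le 0 d0 _ h0).
apply: (@cvg_dominated _ _ _ _ _ (fun s => (2 * k * k) * `|A s - A0|)); last first.
  exact: cvg_dist0.
near=> s.
have sK : bop_comp (Ainv s) (A s) = bop_id by near: s.
have small : k * `|A s - A0| <= 2^-1 by near: s.
have := dle s sK; rewrite (distrC A0) (mulrC _ k) => le1.
apply: (le_trans le1); rewrite -mulrA ler_wpM2r ?mulr_ge0 ?normr_ge0//.
have : `|Ainv s| <= `|Ainv s - A0inv| + k.
  by rewrite -{1}(subrK A0inv (Ainv s)) ler_normD.
have := ler_wpM2l (normr_ge0 (Ainv s)) small.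
by lra.
Unshelve. all: by end_near. Qed.

End Operators.

(** * The evolution operator and the comparison function zeta *)

Section Evolution.
Context {R : realType} {X : normedModType R} (B U Uinv : R -> bop X).
Context (hU : evolution_operator B U Uinv).
Context (beta : R -> R) (hbeta0 : forall t : R, 0 <= t -> 0 <= beta t).
Context (hbetaL1 : L1loc beta).
Local Notation mu := (@lebesgue_measure R).

Lemma evolution_derivative : exists dU : R -> bop X,
  {within `[0, +oo[, continuous dU} /\
  forall t : R, 0 <= t ->
    derivative_within `[0, +oo[ U t (dU t) /\ dU t = bop_comp (B t) (U t).
Proof.
have [[dU [cdU h]] _ _] := hU; exists dU; split=> // t t0.
by apply: h; rewrite /= in_itv /= t0.
Qed.

Lemma evolution0 x : Uinv 0 x = x.
Proof.
have [_ U0 hK] := hU; have [_ K] := hK 0 (lexx 0).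
by have := congr1 (fun A : bop X => A x) K; rewrite /= U0.
Qed.

Lemma evolutionK (t : R) x : 0 <= t -> U t (Uinv t x) = x.
Proof.
have [_ _ hK] := hU; move=> /hK[K _].
by have := congr1 (fun A : bop X => A x) K.
Qed.

Lemma evolutionVK (t : R) x : 0 <= t -> Uinv t (U t x) = x.
Proof.
have [_ _ hK] := hU; move=> /hK[_ K].
by have := congr1 (fun A : bop X => A x) K.
Qed.

Lemma evolution_cvg (t : R) : 0 <= t -> U s @[s --> within `[0, +oo[ (nbhs t)] --> U t.
Proof.
have [dU [_ h]] := evolution_derivative.
by move=> /h[/derivative_within_cvg].
Qed.

Lemma evolution_inv_cvg (t : R) : 0 <= t ->
  Uinv s @[s --> within `[0, +oo[ (nbhs t)] --> Uinv t.
Proof.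
move=> t0; have [_ _ hK] := hU.
apply: (@cvg_bop_inv _ _ _ _ _ U _ (U t)) (evolution_cvg t0).
- apply: filterS (withinT _ _) => s /=; rewrite in_itv /= andbT => s0.
  by have [] := hK s s0.
- by have [] := hK t t0.
Qed.

Lemma evolution_norm_gt0 (t : R) (x : X) : x != 0 -> 0 <= t -> 0 < `|U t|.
Proof.
move=> x0 t0; rewrite lt_neqAle normr_ge0 andbT eq_sym.
apply/negP => /eqP Ut0; move/negP: x0; apply; rewrite -normr_le0.
rewrite -(evolutionVK x t0); apply: le_trans (bop_norm_apply _ _) _.
have := bop_norm_apply (U t) x; rewrite Ut0 mul0r => Utx.
by rewrite mulr_ge0_le0.
Qed.

Lemma kernel_integrable A (T : R) : 0 <= T ->
  mu.-integrable `[0, T] (EFin \o (fun xi => `|bop_comp A (Uinv xi)| * beta xi)).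
Proof.
move=> T0; pose k xi := `|bop_comp A (Uinv xi)|.
have ck : {within `[0, T], continuous (k : R -> R^o)}.
  apply/subspace_continuousP => t; rewrite /= in_itv /= => /andP[t0 tT].
  apply: cvg_norm; apply: cvg_bop_comp.
  exact: cvg_within_sub (@subset_segment_ray _ T) (evolution_inv_cvg t0).
have [M [_ kM]] := compact_bounded (continuous_compact ck (@segment_compact R 0 T)).
have -> : (EFin \o (fun xi => k xi * beta xi)) = ((EFin \o k) \* (EFin \o beta))%E.
  by [].
apply: integrableMr => //; last exact: hbetaL1.
- by apply: subspace_continuous_measurable_fun.
- exists M; split; first exact: num_real.
  by move=> N MN t tT; apply: kM => //; exists t.
Qed.

Lemma kernel_ge0 A (T : R) : 0 <= T ->
  0 <= \int[mu]_(xi in `[0, T]) (`|bop_comp A (Uinv xi)| * beta xi).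
Proof.
move=> T0; apply: Rintegral_ge0 => t; rewrite /= in_itv /= => /andP[t0 _].
by rewrite mulr_ge0 ?normr_ge0 ?hbeta0.
Qed.

Lemma zeta_gt0 u0 (t : R) : u0 != 0 -> 0 <= t -> 0 < zeta U Uinv beta u0 t.
Proof.
move=> u00 t0; rewrite /zeta ltr_wpDr ?kernel_ge0//.
by rewrite mulr_gt0//; [exact: evolution_norm_gt0 u00 t0|rewrite normr_gt0].
Qed.

Lemma zeta0_ge u0 : `|u0| <= zeta U Uinv beta u0 0.
Proof.
have [_ U0 _] := hU; rewrite /zeta ler_wpDr ?kernel_ge0// U0.
exact: (bop_norm_apply bop_id u0).
Qed.

(** Right lower semicontinuity of zeta at [t]. Cutting the integral in
    [zeta s] at [t] and replacing [U s] by [U t] in the integrand costs at most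
    [|U s - U t| * int_0^t |Uinv| beta], which gives the minorant [psi]. *)
Lemma zeta_lower u0 (t : R) : 0 <= t -> exists2 psi : R -> R,
  psi s @[s --> within `[0, +oo[ (nbhs t)] --> zeta U Uinv beta u0 t &
  forall s, t <= s -> psi s <= zeta U Uinv beta u0 s.
Proof.
move=> t0.
pose I A T := \int[mu]_(xi in `[0, T]) (`|bop_comp A (Uinv xi)| * beta xi).
pose K := I bop_id t.
exists (fun s => `|U s| * `|u0| + (I (U t) t - K * `|U s - U t|)).
  rewrite /zeta; apply: cvgD.
    by apply: cvgMr_tmp; apply: cvg_norm; exact: evolution_cvg.
  rewrite -[X in _ --> X]subr0; apply: cvgB; first exact: cvg_cst.
  by apply: cvg_dist0; exact: evolution_cvg.
move=> s ts; have s0 := le_trans t0 ts.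
rewrite /zeta lerD2l; apply: (@le_trans _ _ (I (U s) t)); last first.
  rewrite [leRHS](@Rintegral_itv_split _ _ _ t)//; last exact: kernel_integrable.
  rewrite lerDl; apply: Rintegral_ge0 => x; rewrite /= in_itv /= => /andP[tx _].
  by rewrite mulr_ge0 ?normr_ge0 ?hbeta0// (le_trans t0).
pose d := `|U s - U t|.
have iK : mu.-integrable `[0, t]
    (EFin \o (fun xi => d * (`|bop_comp bop_id (Uinv xi)| * beta xi))).
  by apply: (integrableZl _ d (kernel_integrable bop_id t0)).
rewrite lerBlDr /K /I mulrC -RintegralZl//; last exact: kernel_integrable.
have iD : mu.-integrable `[0, t]
    (EFin \o (fun xi => `|bop_comp (U s) (Uinv xi)| * beta xi +
                        d * (`|bop_comp bop_id (Uinv xi)| * beta xi))).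
  by apply: (integrableD _ (kernel_integrable (U s) t0) iK).
rewrite -RintegralD//; last exact: kernel_integrable.
apply: le_Rintegral => //; first exact: kernel_integrable.
move=> x; rewrite /= in_itv /= => /andP[x0 _].
rewrite mulrA -mulrDl ler_wpM2r ?hbeta0//.
have -> : bop_comp bop_id (Uinv x) = Uinv x by exact: bop_ext.
have -> : bop_comp (U t) (Uinv x) =
    bop_comp (U s) (Uinv x) - bop_comp (U s - U t) (Uinv x).
  by rewrite bop_compBl opprB addrC subrK.
apply: le_trans (ler_normB _ _) _.
by rewrite lerD2l; exact: bop_comp_norm_le.
Qed.

(** The mean value inequality for [g s = U T (Uinv s (u s))], which joins
    [U T (u 0)] to [u T]. In its derivative [U T (Uinv s (du s - B s (u s)))], the
    term [B s (u s)] is written [dU s (Uinv s (u s))]: this shows that it is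
    continuous in [s], the coefficient [B] entering only through [dU = B U]. *)
Lemma evolution_estimate (u du : R -> X) (k T : R) : 0 <= T ->
    (forall t, 0 <= t <= T -> derivative_within `[0, T] u t (du t)) ->
    {within `[0, T], continuous du} ->
    (forall t, 0 <= t < T -> `|du t - B t (u t)| <= k * beta t) ->
  `|u T| <= `|U T| * `|u 0| +
    k * \int[mu]_(xi in `[0, T]) (`|bop_comp (U T) (Uinv xi)| * beta xi).
Proof.
move=> T0 hu cdu hk; have [dU [cdU hdU]] := evolution_derivative.
pose g s := U T (Uinv s (u s)).
pose dg s := U T (Uinv s (du s - dU s (Uinv s (u s)))).
have Uinvc (t : R) : 0 <= t -> Uinv s @[s --> within `[0, T] (nbhs t)] --> Uinv t.
  by move=> t0; exact: cvg_within_sub (@subset_segment_ray _ T) (evolution_inv_cvg t0).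
have uc t : 0 <= t <= T -> u s @[s --> within `[0, T] (nbhs t)] --> u t.
  by move=> /hu/derivative_within_cvg.
have duE t : 0 <= t -> dU t (Uinv t (u t)) = B t (u t).
  by move=> t0; have [_ ->] := hdU t t0; rewrite /= evolutionK.
have gder t : 0 <= t <= T -> derivative_within `[0, T] g t (dg t).
  move=> tT; have /andP[t0 _] := tT; rewrite /derivative_within.
  apply: (@cvg_trans _ ((U T (Uinv s ((s - t)^-1 *: (u s - u t) -
      ((s - t)^-1 *: (U s - U t)) (Uinv t (u t))))) @[s --> within `[0, T] t^'])).
    apply: near_eq_cvg; apply: filterS (withinT _ _) => s /=.
    rewrite in_itv /= => /andP[s0 _].
    rewrite /g -[in RHS]bopB -bopZ; congr (U T _).
    rewrite -[LHS]/(Uinv s ((s - t)^-1 *: (u s - u t) -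
      (s - t)^-1 *: (U s (Uinv t (u t)) - U t (Uinv t (u t))))).
    rewrite evolutionK// -scalerBr bopZ; congr (_ *: _).
    rewrite -[in RHS](evolutionVK (Uinv t (u t)) s0) -bopB; congr (Uinv s _).
    by rewrite opprB addrA subrK.
  have [dUt _] := hdU t t0.
  apply: cvg_bop_apply; first exact: cvg_cst.
  apply: cvg_bop_apply; first exact/cvg_within_dnbhs/Uinvc.
  apply: cvgB; first exact: hu.
  apply: cvg_bop_apply; last exact: cvg_cst.
  exact: (derivative_within_sub (@subset_segment_ray _ T) dUt).
have gcont : {within `[0, T], continuous dg}.
  apply/subspace_continuousP => t; rewrite /= in_itv /= => tT.
  have /andP[t0 _] := tT.
  apply: cvg_bop_apply; first exact: cvg_cst.
  apply: cvg_bop_apply; first exact: Uinvc.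
  apply: cvgB.
    by move: cdu => /subspace_continuousP; apply; rewrite /= in_itv.
  apply: cvg_bop_apply; last by apply: cvg_bop_apply; [exact: Uinvc|exact: uc].
  have dUt : dU s @[s --> within `[0, +oo[ (nbhs t)] --> dU t.
    by move: cdU => /subspace_continuousP; apply; rewrite /= in_itv /= t0.
  exact: cvg_within_sub (@subset_segment_ray _ T) dUt.
have iK := kernel_integrable (U T) T0.
have ikK : mu.-integrable `[0, T]
    (EFin \o (fun xi => k * (`|bop_comp (U T) (Uinv xi)| * beta xi))).
  by apply: (integrableZl _ k iK).
have := norm_increment_le T0 gder gcont ikK.
rewrite RintegralZl// => H.
have gT : g T = u T by rewrite /g evolutionK.
have g0 : g 0 = U T (u 0) by rewrite /g evolution0.
rewrite -(subrK (g 0) (u T)) addrC.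
apply: le_trans (ler_normD _ _) _; apply: lerD; first by rewrite g0 bop_norm_apply.
rewrite -gT; apply: H => t tT; have /andP[t0 _] := tT.
rewrite /dg duE// mulrCA.
apply: le_trans (bop_norm_apply (bop_comp (U T) (Uinv t)) _) _.
by rewrite ler_wpM2l// hk.
Qed.

End Evolution.

(** * Solutions of an abstract differential equation *)

Section Solutions.
Context {R : realType} {V : completeNormedModType R} (G : R -> V -> V).
Context (hG : {within [set z : R * V | 0 <= z.1], continuous (fun z => G z.1 z.2)}).
Local Notation mu := (@lebesgue_measure R).
Implicit Types (I J : set R) (u v w : R -> V) (t s T d : R).

(** Equivalent to [classical_solution] on intervals of nonnegative times when
    [G] is continuous ([classical_solutionP]), but local in time, hence easier to
    restrict and to glue. *)
Definition solves I u := forall t, I t -> derivative_within I u t (G t (u t)).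

Lemma solves_sub I J u : J `<=` I -> solves I u -> solves J u.
Proof. by move=> JI h t Jt; apply: derivative_within_sub JI (h t (JI _ Jt)). Qed.

Lemma cvg_rhs {F : set_system R} {FF : Filter F} u t l : 0 <= t ->
  (\forall s \near F, 0 <= s) -> s @[s --> F] --> t -> u s @[s --> F] --> l ->
  G s (u s) @[s --> F] --> G t l.
Proof.
move=> t0 F0 Ft ul.
apply: (@cvg_within_comp _ _ _ F _ [set z : R * V | 0 <= z.1]
  (fun s => (s, u s)) (fun z => G z.1 z.2) (t, l)) => //.
- exact: (cvg_pair Ft ul).
- exact: (iffLR (subspace_continuousP _ _) hG (t, l) t0).
Qed.

Lemma solves_rhs_continuous I u : I `<=` `[0, +oo[ -> solves I u ->
  {within I, continuous (fun t => G t (u t))}.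
Proof.
move=> I0 h; apply/subspace_continuousP => t It.
have ge0 s : I s -> 0 <= s by move=> /I0; rewrite /= in_itv /= andbT.
apply: cvg_rhs; first exact: ge0.
- by apply: filterS (withinT _ _) => s /ge0.
- by apply: cvg_within_filter; exact: cvg_id.
- exact: derivative_within_cvg (h t It).
Qed.

Lemma classical_solutionP I u : I `<=` `[0, +oo[ ->
  classical_solution G I u <-> solves I u.
Proof.
move=> I0; split=> [[du [_ h]] t It|h].
  by have [hd <-] := h t It.
exists (fun t => G t (u t)); split; first exact: solves_rhs_continuous.
by move=> t It; split=> //; exact: h.
Qed.

(** At the junction [T] both one-sided derivatives are [G T (u T)], by the
    equation itself. *)
Lemma solves_glue T d u w : 0 <= T -> solves `[0, T] u ->
    solves `[T, T + d[ w -> w T = u T ->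
  solves `[0, T + d[ (fun t => if t <= T then u t else w t).
Proof.
move=> T0 hu hw wT; set z := fun t => _; move=> t.
have zu s : s <= T -> z s = u s by rewrite /z => ->.
have zw s : T <= s -> z s = w s.
  rewrite /z; case: (leP s T) => // sT Ts.
  by have -> : s = T by apply: le_anti; rewrite sT Ts.
rewrite /= in_itv /= => /andP[t0 td]; have [tT|Tt|tT] := ltgtP t T.
- apply: (@derivative_within_local _ _ `[0, T] _ u _ _ _ (T - t)).
  + by rewrite subr_gt0.
  + by rewrite zu// ltW.
  + move=> s; rewrite /= !in_itv /= => /andP[s0 _]; rewrite ltr_norml => /andP[_ st].
    have sT : s <= T by lra.
    by rewrite s0 sT zu.
  + by rewrite zu ?ltW//; apply: hu; rewrite /= in_itv /= t0 ltW.
- apply: (@derivative_within_local _ _ `[T, T + d[ _ w _ _ _ (t - T)).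
  + by rewrite subr_gt0.
  + by rewrite zw// ltW.
  + move=> s; rewrite /= !in_itv /= => /andP[s0 sd]; rewrite ltr_norml => /andP[st _].
    have sT : T <= s by lra.
    by rewrite sd sT zw.
  + by rewrite zw ?ltW//; apply: hw; rewrite /= in_itv /= td ltW.
- subst t; apply: (@derivative_within_sub _ _ (`[0, T] `|` `[T, T + d[)).
    move=> s; rewrite /= !in_itv /= => /andP[s0 sd].
    by have [sT|Ts] := leP s T; [left; rewrite s0|right; rewrite sd ltW].
  rewrite zu//; apply: derivative_withinU.
  + apply: (@derivative_within_local _ _ `[0, T] _ u _ _ _ 1) => //.
    * by rewrite zu.
    * move=> s sI _; split=> //; move: sI.
      by rewrite /= in_itv /= => /andP[s0 sT]; rewrite zu.
    * by apply: hu; rewrite /= in_itv /= t0 lexx.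
  + apply: (@derivative_within_local _ _ `[T, T + d[ _ w _ _ _ 1) => //.
    * by rewrite zw.
    * move=> s sI _; split=> //; move: sI.
      by rewrite /= in_itv /= => /andP[s0 sT]; rewrite zw.
    * by rewrite -wT; apply: hw; rewrite /= in_itv /= td lexx.
Qed.

Lemma solves_extend T u r : 0 <= T -> solves `[0, T] u ->
    locally_solvable G r -> `|u T| < r ->
  exists2 d, 0 < d & exists2 z, solves `[0, T + d[ z &
    forall t, t <= T -> z t = u t.
Proof.
move=> T0 hu hr uT; have [d d0 [w [hw wT _]]] := hr T (u T) T0 uT.
exists d => //; exists (fun t => if t <= T then u t else w t).
  apply: solves_glue => //; apply/classical_solutionP => //.
  by apply: subset_itv; rewrite bnd_simp.
by move=> t ->.
Qed.

Lemma solves_increment u I s t m : s <= t -> `[s, t] `<=` I ->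
  I `<=` `[0, +oo[ -> solves I u ->
  mu.-integrable `[s, t] (EFin \o m) ->
  (forall x, s <= x < t -> `|G x (u x)| <= m x) ->
  `|u t - u s| <= \int[mu]_(x in `[s, t]) m x.
Proof.
move=> st stI I0 h im hm.
have h' := solves_sub stI h.
apply: (@norm_increment_le _ _ u (fun t => G t (u t))) => //.
by apply: solves_rhs_continuous => //; apply: subset_trans I0.
Qed.

(** The increments of [u] are bounded by those of the bounded nondecreasing
    function [M t = int_0^t m], so [u] is Cauchy at [T] from the left. Its limit
    [l] completes it to a solution on [[0, T]]: by continuity [G s (u s)] is close
    to [G T l] for [s] near [T], and the mean value inequality for
    [u x - x *: G T l] gives the derivative at [T]. *)
Lemma solves_close T u m : 0 < T -> solves `[0, T[ u ->
    mu.-integrable `[0, T] (EFin \o m) ->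
    (forall t, 0 <= t < T -> `|G t (u t)| <= m t) ->
  exists l, solves `[0, T] (fun t => if t < T then u t else l).
Proof.
move=> T0 h im hm; have sub : `[0, T[ `<=` `[0, +oo[%classic.
  by apply: subset_itv; rewrite bnd_simp.
pose M t := \int[mu]_(x in `[0, t]) m x.
have MB s t : 0 <= s <= t -> t < T -> `|u t - u s| <= M t - M s.
  move=> /andP[s0 st] tT.
  have i0t : mu.-integrable `[0, t] (EFin \o m).
    by apply: integrable_itv_sub im => //; exact: ltW.
  rewrite /M (@Rintegral_itv_split _ _ _ s)// [leRHS]addrC addKr.
  apply: (@solves_increment _ `[0, T[) => //.
  - by apply: subset_itv; rewrite bnd_simp.
  - by apply: integrable_itv_sub i0t.
  - by move=> x xst; apply: hm; lra.
have MT t : 0 <= t < T -> M t <= M T.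
  move=> /andP[t0 tT]; rewrite /M (@Rintegral_itv_split _ _ _ t T)//; last exact: ltW.
  rewrite lerDl.
  have -> : 0 = \int[mu]_(x in `[t, T]) (0 : R).
    by rewrite Rintegral_itv_cst ?mul0r// ltW.
  apply: le_Rintegral_itvr.
  - by apply: continuous_compact_integrable;
      [exact: segment_compact|exact: cst_continuous].
  - by apply: integrable_itv_sub im.
  - by move=> x xT; apply: le_trans (hm x _); [exact: normr_ge0|lra].
have cu : cvg (u t @[t --> T^'-]).
  apply/cauchy_cvgP/cauchy_exP => e e0.
  pose S := [set M t | t in [set t | 0 <= t < T]].
  have supS : has_sup S.
    split; first by exists (M 0), 0 => //=; rewrite lexx.
    by exists (M T) => _ [t tT <-]; exact: MT.
  have [_ [s /= /andP[s0 sT] <-] hs] := sup_adherent e0 supS.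
  exists (u s); near=> t.
  have st : s < t by near: t; exact: nbhs_left_gt.
  have tT : t < T by near: t; exact: nbhs_left_lt.
  rewrite /= -ball_normE /= distrC; apply: le_lt_trans (MB s t _ _) _ => //.
    by rewrite s0 ltW.
  have : M t <= sup S.
    by apply: sup_upper_bound => //; exists t => //=; lra.
  by lra.
set l := lim (u t @[t --> T^'-]) in cu; exists l.
set z := fun t => _ => t; rewrite /= in_itv /= => /andP[t0].
have zu s : s < T -> z s = u s by rewrite /z => ->.
have zT : z T = l by rewrite /z ltxx.
rewrite le_eqVlt => /predU1P[->{t t0}|tT]; last first.
  apply: (@derivative_within_local _ _ `[0, T[ _ u _ _ _ (T - t)).
  + by rewrite subr_gt0.
  + by rewrite zu.
  + move=> s; rewrite /= !in_itv /= => /andP[s0 _]; rewrite ltr_norml => /andP[_ st].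
    have sT : s < T by lra.
    by rewrite s0 sT zu.
  + by rewrite zu//; apply: h; rewrite /= in_itv /= t0 tT.
set L := G T (z T); apply/derivative_withinP => e e0.
have GL : G s (u s) @[s --> T^'-] --> L.
  rewrite /L zT; apply: cvg_rhs => //; first exact: ltW.
  - near=> s; have : 0 < s by near: s; exact: nbhs_left_gt.
    exact: ltW.
  - exact: cvg_at_left_filter.
have /cvgrPdist_le/(_ _ e0)/nbhs_ballP[d /= d0 hd] := GL.
exists d => // s; rewrite /= in_itv /= => /andP[s0].
rewrite le_eqVlt => /predU1P[->|sT sd].
  by rewrite !subrr scale0r subr0 !normr0 mulr0.
(* the mean value inequality up to t < T; the case t = T follows in the limit *)
have wle t : s <= t < T -> `|u t - u s - (t - s) *: L| <= e * (T - s).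
  move=> /andP[st tT].
  have sub' : `[s, t] `<=` `[0, T[ by apply: subset_itv; rewrite bnd_simp.
  have h' := solves_sub sub' h.
  have := @norm_increment_le _ _ (fun x => u x - x *: L)
    (fun x => G x (u x) - L) (fun=> e) s t st.
  rewrite Rintegral_itv_cst// => H.
  have -> : u t - u s - (t - s) *: L = u t - t *: L - (u s - s *: L).
    by rewrite scalerBl opprD addrACA -opprD.
  apply: le_trans (H _ _ _ _) _.
  - move=> x xst; apply/derivative_withinP => r r0.
    have /derivative_withinP/(_ _ r0)[b b0 hb] : derivative_within `[s, t] u x (G x (u x)).
      by apply: h'; rewrite /= in_itv.
    exists b => // y Iy yb.
    suff -> : u y - y *: L - (u x - x *: L) - (y - x) *: (G x (u x) - L) =
      u y - u x - (y - x) *: G x (u x) by exact: hb.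
    by rewrite opprD addrACA -opprD -scalerBl scalerBr opprB addrA subrK.
  - apply/subspace_continuousP => x xst; apply: cvgB; last exact: cvg_cst.
    apply: (iffLR (subspace_continuousP _ _) (solves_rhs_continuous _ h')) => //.
    exact: subset_trans sub.
  - by apply: continuous_compact_integrable;
      [exact: segment_compact|exact: cst_continuous].
  - move=> x /andP[sx xt]; rewrite distrC; apply: hd; last by rewrite /=; lra.
    rewrite /ball /=; move: sd; rewrite ltr0_norm ?gtr0_norm; lra.
  - by rewrite ler_pM2l//; lra.
rewrite zu// zT.
have -> : `|u s - l - (s - T) *: L| = `|l - u s - (T - s) *: L|.
  by rewrite -normrN opprD opprK opprB -(opprB T s) scaleNr.
rewrite ltr0_norm; last by lra.
rewrite opprB.
have lim_s : `|u t - u s - (t - s) *: L| @[t --> T^'-] --> `|l - u s - (T - s) *: L|.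
  apply: cvg_norm; apply: cvgB; first by apply: cvgB => //; exact: cvg_cst.
  apply: cvgZr_tmp; apply: cvgB; last exact: cvg_cst.
  exact: cvg_at_left_filter.
apply: (cvgr_to_le lim_s); near=> t; apply: wle; apply/andP; split.
- by apply: ltW; near: t; exact: nbhs_left_gt.
- by near: t; exact: nbhs_left_lt.
Unshelve. all: by end_near. Qed.

End Solutions.

(** * Uniqueness and global existence *)

Section Global.
Context {R : realType} {V : completeNormedModType R} (G : R -> V -> V).
Context (hG : {within [set z : R * V | 0 <= z.1], continuous (fun z => G z.1 z.2)}).
Local Notation mu := (@lebesgue_measure R).
Implicit Types (I J : set R) (u v w : R -> V) (t s T d : R).

(** The two solutions agree at a time [t] by continuity if they agree before
    [t]; local solvability at [(t, u t)] then makes both equal to the local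
    solution on a right neighbourhood of [t]. *)
Lemma solves_unique u v : solves G `[0, +oo[ u -> solves G `[0, +oo[ v ->
    u 0 = v 0 ->
    (forall t, 0 <= t -> exists2 r, `|u t| < r & locally_solvable G r) ->
  forall t, 0 <= t -> v t = u t.
Proof.
move=> hu hv uv0 hr b b0.
have ray t : 0 <= t -> `[0, +oo[%classic t by rewrite /= in_itv /= andbT.
apply: (@real_induction R 0 b (fun t => v t = u t)) => [|t /andP[t0 _] vut|t /andP[t0 tb] vu|].
- by [].
- have [r ur hlr] := hr t t0.
  have [d d0 [w [hw wt wuniq]]] := hlr t (u t) t0 ur.
  have sub : `[t, t + d[ `<=` `[0, +oo[%classic.
    by apply: subset_itv; rewrite bnd_simp.
  exists d => // s /andP[ts sd] _.
  have Is : t <= s < t + d by rewrite sd ltW.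
  rewrite (wuniq u)//; last by apply/(classical_solutionP hG) => //; exact: solves_sub hu.
  by rewrite (wuniq v)//; apply/(classical_solutionP hG) => //; exact: solves_sub hv.
- have lim f : solves G `[0, +oo[ f -> f s @[s --> t^'-] --> f t.
    move=> hf S /(derivative_within_cvg (hf t (ray t (ltW t0)))) hS.
    have nS : \forall s \near t, `[0, +oo[%classic s -> S (f s) by exact: hS.
    have nS' : \forall s \near t^'-, `[0, +oo[%classic s -> S (f s).
      by apply: cvg_within; exact: nS.
    have pos : \forall s \near t^'-, 0 < s by exact: nbhs_left_gt.
    suff : \forall s \near t^'-, S (f s) by [].
    by apply: filterS2 pos nS' => s s0; apply; apply: ray; exact: ltW.
  apply: (cvg_unique _ (lim v hv)); first exact: norm_hausdorff.
  apply: cvg_trans (lim u hu); apply: near_eq_cvg; near=> s; symmetry; apply: vu.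
  apply/andP; split; last by near: s; exact: nbhs_left_lt.
  by apply: ltW; near: s; exact: nbhs_left_gt.
- by rewrite b0 lexx.
Unshelve. all: by end_near. Qed.

(** Zorn's lemma on pairs of a final time [T] and a solution on [[0, T[], ordered
    by extension. The union of a chain is a solution; if its final times are
    unbounded this is already a global solution. A maximal solution on [[0, T[]
    would extend to [[0, T]] and then beyond. *)
Lemma solves_global x0 :
    (exists2 r, `|x0| < r & locally_solvable G r) ->
    (forall T u, 0 < T -> solves G `[0, T[ u -> u 0 = x0 ->
      exists2 m, mu.-integrable `[0, T] (EFin \o m) &
        forall t, 0 <= t < T -> `|G t (u t)| <= m t) ->
    (forall T u, 0 <= T -> solves G `[0, T] u -> u 0 = x0 ->
      exists2 r, `|u T| < r & locally_solvable G r) ->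
  exists2 u, solves G `[0, +oo[ u & u 0 = x0.
Proof.
move=> [r0 x0r hr0] hm hr; apply: contrapT => noglobal.
pose sol (e : R * (R -> V)) := [/\ 0 < e.1, solves G `[0, e.1[ e.2 & e.2 0 = x0].
pose S := {e : R * (R -> V) | sol e}.
pose ext (e f : S) := `[< (sval e).1 <= (sval f).1 /\
  forall t, 0 <= t < (sval e).1 -> (sval f).2 t = (sval e).2 t >].
(* every solution on a closed interval [0, T], even for T = 0, extends *)
have step T u : 0 <= T -> solves G `[0, T] u -> u 0 = x0 ->
    exists2 e : S, T < (sval e).1 & forall t, t <= T -> (sval e).2 t = u t.
  move=> T0 hu u0; have [r ur hlr] := hr T u T0 hu u0.
  have [d d0 [z hz zu]] := solves_extend hG T0 hu hlr ur.
  have ez : sol (T + d, z).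
    by split => //=; [lra|rewrite zu].
  by exists (exist _ _ ez) => //=; lra.
have triv : solves G `[0, 0] (fun=> x0).
  move=> t; rewrite /= in_itv /= => /le_anti <-.
  apply/derivative_withinP => e e0; exists 1 => // s.
  rewrite /= in_itv /= => /le_anti <- _.
  by rewrite !subrr scale0r subr0 !normr0 mulr0.
have [e0 _ _] := step 0 _ (lexx 0) triv erefl.
have [||A Atot|[[T u] [/= T0 hu u0]] emax] := @ZL_preorder S e0 ext.
- by move=> e; apply/asboolP.
- move=> f e g /asboolP[fe1 fe2] /asboolP[eg1 eg2]; apply/asboolP; split.
    exact: le_trans fe1 eg1.
  move=> t /andP[t0 tf]; rewrite eg2 ?fe2 ?t0//=.
  exact: lt_le_trans fe1.
- have [[a Aa]|A0] := pselect (A !=set0); last first.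
    by exists e0 => s As; exfalso; apply: A0; exists s.
  pose D := [set t | 0 <= t /\ exists2 e, A e & t < (sval e).1].
  (* the union of the chain: z t is read off any member of A defined at t *)
  pose z t := if pselect (exists2 e, A e & t < (sval e).1) is left h
    then (sval (s2val (cid2 h))).2 t else x0.
  have zE e t : A e -> 0 <= t < (sval e).1 -> z t = (sval e).2 t.
    move=> Ae /andP[t0 te]; rewrite /z; case: pselect => [h|]; last by case; exists e.
    case: (cid2 h) => f Af /= tf.
    have [/asboolP[_ ->]|/asboolP[_ ->]] := Atot _ _ Ae Af; rewrite ?t0//.
  have z0 : z 0 = x0.
    by have [apos _ a0] := svalP a; rewrite (zE a)// lexx.
  have solD : solves G D z.
    move=> t [t0 [e Ae te]].
    have [_ he _] := svalP e.
    rewrite (zE e) ?t0//.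
    apply: (@derivative_within_local _ _ `[0, (sval e).1[ _ (sval e).2 _ _ _ ((sval e).1 - t)).
    + by rewrite subr_gt0.
    + by rewrite (zE e)// t0.
    + move=> s [s0 _]; rewrite ltr_norml => /andP[_ st].
      have se : s < (sval e).1 by lra.
      by rewrite /= in_itv /= s0 se (zE e)// s0.
    + by apply: he; rewrite /= in_itv /= t0.
  have [[b b0 hb]|hD] := pselect (exists2 b, 0 <= b & forall e, A e -> (sval e).1 <= b); last first.
    exfalso; apply: noglobal; exists z => //.
    apply: solves_sub solD => t; rewrite /= in_itv /= andbT => t0; split=> //.
    apply: contrapT => h; apply: hD; exists t => // e Ae.
    by rewrite leNgt; apply/negP => te; apply: h; exists e.
  pose H := [set (sval e).1 | e in A].
  have supH : has_sup H.
    by split; [exists (sval a).1, a|exists b => _ [e Ae <-]; exact: hb].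
  have leH e : A e -> (sval e).1 <= sup H.
    by move=> Ae; apply: sup_upper_bound => //; exists e.
  have ez : sol (sup H, z).
    split => //=.
    + by apply: lt_le_trans (leH a Aa); have [] := svalP a.
    + apply: solves_sub solD => t; rewrite /= in_itv /= => /andP[t0 tH]; split=> //.
      have tp : 0 < sup H - t by rewrite subr_gt0.
      have [_ [e Ae <-]] := sup_adherent tp supH; rewrite subKr => te.
      by exists e.
  exists (exist _ _ ez) => e Ae; apply/asboolP => /=; split; first exact: leH.
  by move=> t te; exact: zE.
- have [m im hmu] := hm T u T0 hu u0.
  have [l hl] := solves_close hG T0 hu im hmu.
  have [||e Te eu] := step T _ _ hl.
  + exact: ltW.
  + by rewrite T0.
  have : ext (exist _ (T, u) (And3 T0 hu u0)) e.
    apply/asboolP => /=; split; first exact: ltW.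
    by move=> t /andP[_ tT]; rewrite eu ?ltW// tT.
  by move=> /emax /asboolP[/= eT _]; lra.
Qed.

End Global.

(** * The a priori bound and its consequences *)

(** The role of the hypothesis on alpha: while the solution is below the bound
    [z], the nonlinear term [a * y `^ p] is at most [k * b]. *)
Lemma perturbation_le {R : realType} (a b k z y p : R) : 0 < z -> 0 <= y <= z ->
  0 <= b -> 0 <= k -> 1 < p -> a <= k * b / z `^ p -> a * y `^ p <= k * b.
Proof.
move=> z0 /andP[y0 yz] b0 k0 p1 ha.
have zp : 0 < z `^ p by exact: powR_gt0.
apply: le_trans (ler_wpM2r (powR_ge0 y p) ha) _.
rewrite mulrAC ler_pdivrMr// ler_wpM2l ?mulr_ge0//.
by apply: ge0_ler_powR; rewrite ?nnegrE//; lra.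
Qed.

Section Apriori.
Context {R : realType} {X : completeNormedModType R}.
Context (G : R -> X -> X) (B U Uinv : R -> bop X) (beta : R -> R) (kappa : R) (u0 : X).
Context (hG : {within [set z : R * X | 0 <= z.1], continuous (fun z => G z.1 z.2)}).
Context (hU : evolution_operator B U Uinv).
Context (hbeta0 : forall t : R, 0 <= t -> 0 <= beta t) (hbetaL1 : L1loc beta).
Context (hkappa : 0 < kappa) (hu0 : u0 != 0).
Local Notation bound t := ((kappa + 1) * zeta U Uinv beta u0 t).
Context (hGB : forall (t : R) x, 0 <= t -> `|x| <= bound t ->
  `|G t x - B t x| <= (kappa + 1) * beta t).

(** Bootstrap: [|u| <= bound] on [[0, t[] implies [|u t| < bound t] because
    [evolution_estimate] has the coefficient [1], not [kappa + 1], in front of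
    [|U t| * |u0| > 0]. *)
Lemma apriori_bound (T : R) u : solves G `[0, T] u -> u 0 = u0 ->
  forall t, 0 <= t <= T -> `|u t| < bound t.
Proof.
move=> hu u00; apply: real_induction.
- rewrite u00; apply: le_lt_trans (zeta0_ge hU hbeta0 u0) _.
  by rewrite ltr_pMl ?ltrDr// (zeta_gt0 hU).
- move=> t /andP[t0 tT] ut.
  have [psi psic psile] := zeta_lower hU hbeta0 hbetaL1 u0 t0.
  have It : `[0, T]%classic t by rewrite /= in_itv /= t0 ltW.
  (* |u| - (kappa + 1) psi is continuous and negative at t, hence negative
     slightly later, where psi <= zeta *)
  have phic : `|u s| - (kappa + 1) * psi s @[s --> within `[0, T] (nbhs t)] -->
      `|u t| - bound t.
    apply: cvgB; first exact: (cvg_norm (derivative_within_cvg (hu t It))).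
    by apply: cvgMl_tmp; exact: cvg_within_sub (@subset_segment_ray _ T) psic.
  have neg : 0 < (bound t - `|u t|) / 2 by rewrite divr_gt0// subr_gt0.
  have /cvg_withinP/(_ _ neg)[d d0 hd] := phic.
  exists d => // s /andP[ts sd] sT.
  have := hd s; rewrite /= in_itv /= (le_trans t0 (ltW ts)) sT gtr0_norm ?subr_gt0//.
  rewrite ltrBlDl => /(_ isT sd); rewrite ler_norml => /andP[_].
  have k1 : 0 < kappa + 1 by exact: addr_gt0.
  have : (kappa + 1) * psi s <= bound s by rewrite ler_pM2l// psile// ltW.
  by lra.
- move=> t /andP[t0 tT] hlt.
  have sub : `[0, t] `<=` `[0, T]%classic by apply: subset_itv; rewrite bnd_simp.
  have hut := solves_sub sub hu.
  have := @evolution_estimate _ _ B U Uinv hU beta hbetaL1 u (fun t => G t (u t))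
    (kappa + 1) t (ltW t0) _ _ _.
  move=> H; apply: (le_lt_trans (H _ _ _)).
  + by move=> s st; apply: hut; rewrite /= in_itv.
  + exact: (solves_rhs_continuous hG (@subset_segment_ray _ t) hut).
  + move=> s /andP[s0 st]; apply: hGB => //.
    by apply: ltW; apply: hlt; rewrite s0.
  + rewrite u00 /zeta mulrDr ltrD2r ltr_pMl ?ltrDr//.
    apply: mulr_gt0; last by rewrite normr_gt0.
    exact: (evolution_norm_gt0 hU hu0 (ltW t0)).
Qed.

End Apriori.

Theorem theorem2p11 (R : realType) (X : completeNormedModType R)
  (F : R -> X -> X) (f : R -> X) (B U Uinv : R -> bop X)
  (alpha beta : R -> R) (p kappa : R) (u0 : X)
  (hB : forall t, 0 <= t -> differentiable (F t) 0 /\ forall x, B t x = 'd (F t) 0 x)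
  (hBL1 : L1loc (fun t => `|B t|))
  (hU : evolution_operator B U Uinv)
  (halpha0 : forall t, 0 <= t -> 0 <= alpha t) (halphaL1 : L1loc alpha)
  (hbeta0 : forall t, 0 <= t -> 0 <= beta t) (hbetaL1 : L1loc beta)
  (hp : 1 < p) (hkappa : 0 < kappa)
  (* Continuity of the right-hand side on [0, oo) x X: without it a solution on
     [0, T) and a local solution starting at T need not glue to a C^1 function. *)
  (hcont : {within [set z : R * X | 0 <= z.1],
              continuous (fun z => F z.1 z.2 + f z.1)})
  (hF : forall t u, 0 <= t -> `|F t u - B t u| <= alpha t * `|u| `^ p)
  (hf : forall t, 0 <= t -> `|f t| <= beta t)
  (hA : locally_solvable_large (fun t x => F t x + f t)
          (fun t => (kappa + 1) * zeta U Uinv beta u0 t))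
  (halpha : forall t, 0 <= t ->
     alpha t <= kappa * beta t / ((kappa + 1) * zeta U Uinv beta u0 t) `^ p)
  (hu0 : u0 != 0) :
  exists u : R -> X,
    [/\ classical_solution (fun t x => F t x + f t) `[0, +oo[ u,
        u 0 = u0 &
        forall v : R -> X,
          classical_solution (fun t x => F t x + f t) `[0, +oo[ v ->
          v 0 = u0 -> forall t, 0 <= t -> v t = u t] /\
    [/\ forall t, 0 <= t -> `|u t| < (kappa + 1) * zeta U Uinv beta u0 t,
        [bounded zeta U Uinv beta u0 t | t in `[0, +oo[] ->
          [bounded u t | t in `[0, +oo[] &
        zeta U Uinv beta u0 t @[t --> +oo] --> 0 -> u t @[t --> +oo] --> 0].
Proof.
pose G t x := F t x + f t; pose bound t := (kappa + 1) * zeta U Uinv beta u0 t.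
have hG : {within [set z : R * X | 0 <= z.1], continuous (fun z => G z.1 z.2)} := hcont.
have k1 : 0 < kappa + 1 by exact: addr_gt0.
have bound_gt0 t : 0 <= t -> 0 < bound t.
  by move=> t0; rewrite mulr_gt0// (zeta_gt0 hU).
have hGB t x : 0 <= t -> `|x| <= bound t -> `|G t x - B t x| <= (kappa + 1) * beta t.
  move=> t0 xb; rewrite /G addrAC; apply: le_trans (ler_normD _ _) _.
  rewrite mulrDl mul1r; apply: lerD; last exact: hf.
  apply: le_trans (hF t x t0) _; apply: perturbation_le (bound_gt0 t t0) _ _ _ hp _.
  - by rewrite normr_ge0.
  - exact: hbeta0.
  - exact: ltW.
  - exact: halpha.
have apriori T u : solves G `[0, T] u -> u 0 = u0 ->
    forall t, 0 <= t <= T -> `|u t| < bound t.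
  by move=> hu u00; apply: (apriori_bound hG hU hbeta0 hbetaL1 hkappa hu0 hGB).
have segment_of I u T : 0 <= T -> `[0, T] `<=` I -> solves G I u -> u 0 = u0 ->
    `|u T| < bound T.
  move=> T0 TI hu u00; apply: (apriori T u) => //; last by rewrite T0 lexx.
  exact: solves_sub hu.
have solvable T (x : X) : 0 <= T -> `|x| < bound T ->
    exists2 r, `|x| < r & locally_solvable G r.
  move=> T0 xT; have [r hr hlr] := hA T T0; exists r => //.
  by apply: lt_le_trans xT (hr T _); rewrite T0 lexx.
have [|T u T0 hu u00|T u T0 hu u00|u hu u00] := @solves_global _ _ G hG u0.
- apply: (solvable 0) => //; apply: le_lt_trans (zeta0_ge hU hbeta0 u0) _.
  by rewrite ltr_pMl ?ltrDr// (zeta_gt0 hU).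
- have [r hr _] := hA T (ltW T0).
  exists (fun t => r * `|B t| + (kappa + 1) * beta t).
    have iB := hBL1 T (ltW T0); have ib := hbetaL1 T (ltW T0).
    have i1 : lebesgue_measure.-integrable `[0, T] (EFin \o (fun t => r * `|B t|)).
      by apply: (integrableZl _ r iB).
    have i2 : lebesgue_measure.-integrable `[0, T]
        (EFin \o (fun t => (kappa + 1) * beta t)).
      by apply: (integrableZl _ (kappa + 1) ib).
    by apply: (integrableD _ i1 i2).
  move=> t /andP[t0 tT].
  have sub : `[0, t] `<=` `[0, T[%classic by apply: subset_itv; rewrite bnd_simp.
  have ut := segment_of _ u t t0 sub hu u00.
  rewrite -(subrK (B t (u t)) (G t (u t))) addrC.
  apply: le_trans (ler_normD _ _) _; apply: lerD; last exact: hGB (ltW ut).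
  apply: le_trans (bop_norm_apply _ _) _; rewrite mulrC ler_wpM2r//.
  by apply: le_trans (ltW ut) (hr t _); rewrite t0 ltW.
- by apply: (solvable T) => //; exact: segment_of hu u00.
have ub t : 0 <= t -> `|u t| < bound t.
  by move=> t0; apply: segment_of hu u00 => //; exact: subset_segment_ray.
exists u; split; split=> //.
- exact/(classical_solutionP hG).
- move=> v /(classical_solutionP hG v (@subset_refl _ _)) hv v0.
  apply: (solves_unique hG hu hv); first by rewrite u00.
  by move=> t t0; apply: (solvable t) => //; exact: ub.
- move=> [M [_ hM]]; exists ((kappa + 1) * (M + 1)); split; first exact: num_real.
  move=> N MN t; rewrite /= in_itv /= andbT => t0.
  apply: le_trans (ltW (ub t t0)) _; apply: le_trans (ltW MN).
  rewrite /bound ler_pM2l//; apply: le_trans (ler_norm _) _.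
  have := hM (M + 1); rewrite ltrDl ltr01 => /(_ isT t); apply.
  by rewrite /= in_itv /= t0.
- move=> z0; apply: (@cvg_dominated _ _ _ _ _ _ bound).
    near=> t; rewrite subr0; apply: ltW; apply: ub.
    by near: t; exact: nbhs_pinfty_ge.
  by rewrite -(mulr0 (kappa + 1)); apply: cvgMl_tmp.
Unshelve. all: by end_near. Qed.
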